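(* Let $n\ge1$, $N=2n+1$. Let $\prec$ be a total order on $\mathbb{Z}$ invariant under translation ($i\prec j$ implies $i+N\prec j+N$) and negation ($i\prec j$ implies $-j\prec-i$). Then $\{\widetilde{e}_j-\widetilde{e}_i: i<j,\ i\succ j,\ i\not\equiv j\bmod N\}$ (with $i,j$ ranging over integers not divisible by $N$) is a biclosed set of $\widetilde{C}_n$, and every biclosed set of $\widetilde{C}_n$ is of this form. Two such total orders give the same biclosed set if and only if they are the same up to reversal on intervals of the form $r+N\mathbb{Z}$.
   Context: Let $V$ be the real vector space spanned by $\widetilde{e}_i$, $i\in\mathbb{Z}$, modulo the relations $\widetilde{e}_{i+N}=\widetilde{e}_i+\widetilde{e}_N$ and $\widetilde{e}_{-i}=-\widetilde{e}_i$ (so $\widetilde{e}_0=0$). The root system of $\widetilde{C}_n$ is $\{\widetilde{e}_j-\widetilde{e}_i: i,j\not\equiv0\bmod N,\ i\not\equiv j\bmod N\}$, with positive roots those with $i<j$. A set $B$ of positive roots is biclosed if for positive roots $\alpha,\beta,\gamma$ with $\gamma\in\mathbb{R}_{>0}\alpha+\mathbb{R}_{>0}\beta$: $\alpha,\beta\in B\Rightarrow\gamma\in B$ and $\alpha,\beta\notin B\Rightarrow\gamma\notin B$. ''Reversal on an interval $r+N\mathbb{Z}$'' means reversing the order restricted to a residue class $r+N\mathbb{Z}$ that forms an interval of the total order. *)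

(* Defs.v *)
From HB Require Import structures.
From mathcomp Require Import all_boot all_order all_algebra ring_quotient.
From mathcomp Require Import boolp classical_sets reals monalg.

Set Implicit Arguments.
Unset Strict Implicit.
Unset Printing Implicit Defensive.

Import Order.TTheory GRing.Theory Num.Theory.

Local Open Scope classical_set_scope.
Local Open Scope ring_scope.

Definition modN (n : nat) : int := (n.*2.+1)%:Z.

Section VectorSpace.

Variables (R : realType) (n : nat).

Local Notation N := (modN n).
Local Notation F := {malg R[int]}.
Local Notation gen i := (<< 1 *g i >> : F).

(* {malg R[int]} is the real vector space freely generated by int; one relator
   for each relation e_{i+N} = e_i + e_N and e_{-i} = - e_i. *)
Definition relator : set F :=
  [set x | (exists i : int, x = gen (i + N) - (gen i + gen N))
        \/ (exists i : int, x = gen (- i) - (- gen i))].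

Definition in_relspan (x : F) : Prop :=
  exists s : seq (R * F), (forall p, p \in s -> relator p.2) /\
    x = \sum_(p <- s) p.1 *: p.2.

Definition relspan : {pred F} := fun x => `[< in_relspan x >].

Lemma relspanP x : reflect (in_relspan x) (x \in relspan).
Proof. exact: asboolP. Qed.

Lemma relspanZD (a : R) (x y : F) :
  x \in relspan -> y \in relspan -> a *: x + y \in relspan.
Proof.
move=> /relspanP[s [sP ->]] /relspanP[t [tP ->]]; apply/relspanP.
exists ([seq (a * p.1, p.2) | p <- s] ++ t); split.
  move=> p; rewrite mem_cat => /orP[/mapP[q qs ->]|]; last exact: tP.
  exact: (sP q).
rewrite big_cat big_map scaler_sumr; congr (_ + _).
by apply: eq_bigr => p _; rewrite scalerA.
Qed.

Lemma relspan0 : (0 : F) \in relspan.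
Proof. by apply/relspanP; exists [::]; rewrite big_nil. Qed.

Lemma relspanZ (a : R) (x : F) : x \in relspan -> a *: x \in relspan.
Proof. by move=> xs; rewrite -[_ *: _]addr0 relspanZD // relspan0. Qed.

Lemma relspan_zmod_closed : zmod_closed relspan.
Proof.
split=> [|x y xs ys]; first exact: relspan0.
by rewrite addrC -scaleN1r relspanZD.
Qed.

HB.instance Definition _ := GRing.isZmodClosed.Build F relspan
  relspan_zmod_closed.

Lemma relator_relspan x : relator x -> x \in relspan.
Proof.
move=> xr; apply/relspanP; exists [:: (1, x)]; split.
  by move=> p; rewrite inE => /eqP->.
by rewrite big_seq1 scale1r.
Qed.

(* The library only gives {quot _} a Z-module structure; the R-module structure
   inherited from the free vector space is added below. *)
Definition Vt : Type := (Quotient.quot relspan).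

HB.instance Definition _ := GRing.Zmodule.on Vt.

Definition piV (x : F) : Vt := \pi_(Quotient.quot relspan)%qT x.

Lemma piVP x y : (piV x = piV y) <-> (x - y \in relspan).
Proof.
rewrite Quotient.idealrBE; split=> [/eqP //|/eqP]; exact.
Qed.

Lemma piV_repr (u : Vt) : piV (repr (u : (Quotient.quot relspan))) = u.
Proof. exact: reprK. Qed.

Lemma piV_is_zmod_morphism : zmod_morphism piV.
Proof. by move=> x y; rewrite /piV raddfB. Qed.

HB.instance Definition _ :=
  GRing.isZmodMorphism.Build F Vt piV piV_is_zmod_morphism.

Definition scaleV (a : R) (u : Vt) : Vt :=
  piV (a *: repr (u : (Quotient.quot relspan))).

Lemma scaleV_pi a x : scaleV a (piV x) = piV (a *: x).
Proof.
by apply/piVP; rewrite -scalerBr; apply/relspanZ/piVP; rewrite piV_repr.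
Qed.

Lemma scaleVA a b u : scaleV a (scaleV b u) = scaleV (a * b) u.
Proof. by rewrite -[u]piV_repr !scaleV_pi scalerA. Qed.

Lemma scaleV1 : left_id 1 scaleV.
Proof. by move=> u; rewrite -[u]piV_repr scaleV_pi scale1r. Qed.

Lemma scaleVDr : right_distributive scaleV +%R.
Proof.
move=> a u v; rewrite -[u]piV_repr -[v]piV_repr.
by rewrite -raddfD !scaleV_pi -raddfD scalerDr.
Qed.

Lemma scaleVDl u : {morph scaleV^~ u : a b / a + b}.
Proof. by move=> a b; rewrite -[u]piV_repr !scaleV_pi -raddfD scalerDl. Qed.

HB.instance Definition _ := GRing.Zmodule_isLmodule.Build R Vt
  scaleVA scaleV1 scaleVDr scaleVDl.

Lemma piV_is_scalable : scalable piV.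
Proof. by move=> a x; rewrite -scaleV_pi. Qed.

HB.instance Definition _ :=
  GRing.isScalable.Build R F Vt *:%R piV piV_is_scalable.

(* et i is the generator written \widetilde{e}_i. *)
Definition et (i : int) : Vt := piV (gen i).

Lemma etDN i : et (i + N) = et i + et N.
Proof.
rewrite -raddfD; apply/piVP/relator_relspan.
by left; exists i.
Qed.

Lemma etN i : et (- i) = - et i.
Proof.
rewrite -raddfN; apply/piVP/relator_relspan.
by right; exists i.
Qed.

End VectorSpace.

Arguments Vt : clear implicits.
Arguments piV : clear implicits.
Arguments et : clear implicits.

Section TypeC.

Variables (R : realType) (n : nat).

Local Notation N := (modN n).
Local Notation V := (Vt R n).

Definition root_index (i j : int) : Prop :=
  [/\ ~~ (N %| i)%Z, ~~ (N %| j)%Z & (i != j %[mod N])%Z].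

Definition pos_roots : set V :=
  [set v | exists i j : int,
     [/\ root_index i j, i < j & v = et R n j - et R n i]].

Definition biclosed (B : set V) : Prop :=
  B `<=` pos_roots /\
  forall alpha beta gamma : V,
    pos_roots alpha -> pos_roots beta -> pos_roots gamma ->
    (exists a b : R, [/\ 0 < a, 0 < b & gamma = a *: alpha + b *: beta]) ->
    (B alpha -> B beta -> B gamma) /\
    (~ B alpha -> ~ B beta -> ~ B gamma).

Definition inversions (prec : rel int) : set V :=
  [set v | exists i j : int,
     [/\ root_index i j, i < j, prec j i & v = et R n j - et R n i]].

End TypeC.

Arguments pos_roots : clear implicits.
Arguments inversions : clear implicits.

(* Orders are on all of int, multiples of N included, although only integers
   not divisible by N index roots. *)
Definition strict_total_order (prec : rel int) : Prop :=
  [/\ irreflexive prec, transitive prec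
    & forall i j, i != j -> prec i j || prec j i].

Definition invariant_order (n : nat) (prec : rel int) : Prop :=
  [/\ strict_total_order prec,
      forall i j, prec i j -> prec (i + modN n) (j + modN n)
    & forall i j, prec i j -> prec (- j) (- i)].

Definition residue_class (n : nat) (r : int) : set int :=
  [set i | (i = r %[mod modN n])%Z].

Definition order_interval (prec : rel int) (A : set int) : Prop :=
  forall i k j, A i -> A j -> prec i k -> prec k j -> A k.

(* [C] is a set of residues whose classes are reversed simultaneously: for an
   invariant order, reversing only one of the classes of r and -r breaks
   invariance under negation. *)
Definition reverse_classes (n : nat) (C : set int) (prec : rel int)
    (i j : int) : Prop :=
  if `[< exists2 r, C r & residue_class n r i /\ residue_class n r j >]
  then prec j i else prec i j.

Definition same_up_to_reversal (n : nat) (prec prec' : rel int) : Prop :=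
  exists C : set int,
    (forall r, C r -> order_interval prec (residue_class n r)) /\
    (forall i j, prec' i j <-> reverse_classes n C prec i j).

(* Main.v *)
Require Import Defs.
From HB Require Import structures.
From mathcomp Require Import all_boot all_order all_algebra.
From mathcomp Require Import boolp classical_sets reals monalg.
From mathcomp Require Import zify ring lra.

(**
A root e_j - e_i is an edge i -> j between residues modulo N; a set of positive
roots orients every such pair of integers.

Inversion sets are biclosed: otherwise some relation
a_1(e_{j_1} - e_{i_1}) + a_2(e_{j_2} - e_{i_2}) + a_3(e_{j_3} - e_{i_3}) = 0
has all a_t > 0 and all i_t ≺ j_t.  Every real function f on the integers with
f(i + N) = f(i) + f(N) and f(-i) = -f(i) is a linear functional on the roots,
hence if f is weakly increasing along the three edges it is constant along them.
Applied to indicators of translation invariant upper sets of ≺, this puts all the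
edges inside one class of residues interlaced under ≺ or its negative (three edges
cannot split between two such classes, as no root is a multiple of e_N), on which
counting how many translates of a base point precede y is a weakly increasing f
that is strict on the edge at the base point: a contradiction.

Conversely a biclosed set B gives an orientation without 3-cycles of the pairs of
non-congruent integers, multiples of N being reached through
2(e_j - e_i) = e_j - e_(2i - j) for N | i.  The rank two subsystems {e_j - e_i + k δ}
force k |-> [i -> j + kN] to be monotone, and for fixed i it cannot increase for one j
and decrease for another; this tells how to order the residue class of i.

The inversion set of ≺ determines ≺ on non-congruent integers (on multiples of N by
i ≺ 0 <-> i ≺ -i), and a residue class whose direction is not determined
is an interval.
*)

Set Implicit Arguments.
Unset Strict Implicit.
Unset Printing Implicit Defensive.

Import Order.TTheory GRing.Theory Num.Theory.

Local Open Scope ring_scope.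

(** * Congruence modulo N and functionals *)

Definition congN (n : nat) (i j : int) : bool := (modN n %| j - i)%Z.

Section Congruence.

Variable n : nat.
Local Notation N := (modN n).
Local Notation "i ~~N j" := (congN n i j) (at level 70).

Lemma modN_gt0 : 0 < N. Proof. by []. Qed.

Lemma congNP i j : reflect (exists k, j = i + k * N) (i ~~N j).
Proof.
apply: (iffP dvdzP) => -[k jE]; exists k; first by rewrite -jE; ring.
by rewrite jE; ring.
Qed.

Lemma congN_eqmod i j : congN n i j = (i == j %[mod N])%Z.
Proof. by rewrite /congN -eqz_mod_dvd eq_sym. Qed.

Lemma congNxx i : i ~~N i.
Proof. by rewrite congN_eqmod. Qed.

Lemma congN_sym i j : (i ~~N j) = (j ~~N i).
Proof. by rewrite !congN_eqmod eq_sym. Qed.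

Lemma congN_transl i j k : i ~~N j -> (i ~~N k) = (j ~~N k).
Proof. by rewrite !congN_eqmod => /eqP->. Qed.

Lemma congN_transr i j k : i ~~N j -> (k ~~N i) = (k ~~N j).
Proof. by rewrite !congN_eqmod => /eqP->. Qed.

Lemma congN_shift i k : i ~~N (i + k * N).
Proof. by apply/congNP; exists k. Qed.

Lemma congN_shiftl i j k : (i + k * N ~~N j) = (i ~~N j).
Proof. by apply: congN_transl; rewrite congN_sym congN_shift. Qed.

Lemma congN_shiftr i j k : (i ~~N j + k * N) = (i ~~N j).
Proof. by apply: congN_transr; rewrite congN_sym congN_shift. Qed.

Lemma congN_opp i j : (- i ~~N - j) = (i ~~N j).
Proof. by rewrite congN_sym /congN; congr (_ %| _)%Z; ring. Qed.

Lemma congN0 i : (N %| i)%Z = (0 ~~N i).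
Proof. by rewrite /congN subr0. Qed.

(** Since [N] is odd, 2 is invertible modulo [N], so [N] divides [2 i] only when it divides [i]. *)
Lemma congN_oppxx i : (- i ~~N i) = (N %| i)%Z.
Proof.
have N2 : coprimez N 2.
  rewrite /coprimez -[gcdz _ _]/(gcdn n.*2.+1 2)%:Z.
  by move: (coprimen2 n.*2.+1); rewrite /= odd_double /coprime => /eqP->.
by rewrite /congN opprK -mulr2n -mulr_natr Gauss_dvdzl.
Qed.

Lemma congN_oppr i : (i ~~N - i) = (N %| i)%Z.
Proof. by rewrite congN_sym congN_oppxx. Qed.

Lemma root_indexP i j :
  root_index n i j <-> [/\ ~~ (N %| i)%Z, ~~ (N %| j)%Z & ~~ (i ~~N j)].
Proof. by rewrite congN_eqmod. Qed.

End Congruence.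

Section Functional.

Variables (R : realType) (n : nat).
Local Notation N := (modN n).
Local Notation e := (et R n).

Definition quasi_odd (f : int -> R) : Prop :=
  (forall i, f (i + N) = f i + f N) /\ (forall i, f (- i) = - f i).

(** The linear extension of [f] to the free space kills both kinds of relators, hence factors
    through the quotient. *)
Lemma quasi_odd_functional f : quasi_odd f ->
  exists L : {linear Vt R n -> R^o}, forall i, L (e i) = f i.
Proof.
move=> [fN fopp].
pose F (x : {malg R[int]}) : R := mmap idfun f x.
have FD x y : F (x + y) = F x + F y by rewrite /F raddfD.
have FN x : F (- x) = - F x by rewrite /F raddfN.
have FZ a x : F (a *: x) = a * F x.
  rewrite /F (mmapEw (msuppZ_le a x)) mmapE mulr_sumr.
  by apply: eq_bigr => k _; rewrite mcoeffZ mulrA.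
have Fg i : F << 1 *g i >> = f i by rewrite /F mmapU mul1r.
have Fspan x : x \in relspan (R := R) n -> F x = 0.
  move=> /relspanP[s [sP ->]].
  rewrite (big_morph F FD (raddf0 _)) big_seq big1// => p /sP.
  by rewrite FZ => -[] [i ->]; rewrite !(FD, FN, Fg) ?fN ?fopp; ring.
pose L (u : Vt R n) : R^o := F (repr (u : Quotient.quot (relspan (R := R) n))).
have LF x : L (piV R n x) = F x.
  apply/eqP; rewrite -subr_eq0 -FN -FD; apply/eqP/Fspan/piVP.
  by rewrite piV_repr.
have Llin : linear L.
  move=> a u v; rewrite -[u]piV_repr -[v]piV_repr -linearZ -linearD !LF.
  by rewrite FD FZ.
pose LL := GRing.isLinear.Build R (Vt R n) R^o *:%R L Llin.
pose L' : {linear Vt R n -> R^o} := HB.pack L LL.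
exists L' => i.
exact: etrans (LF _) (Fg _).
Qed.

End Functional.

(** * Linear relations between roots *)

Section RootRelations.

Variables (R : realType) (n : nat).
Local Notation N := (modN n).
Local Notation e := (et R n).

Lemma quasi_odd_intr : quasi_odd n (fun i => i%:~R : R).
Proof. by split=> i; rewrite ?rmorphD ?rmorphN. Qed.

Lemma quasi_odd_invariant (f : int -> R) :
  (forall i, f (i + N) = f i) -> (forall i, f (- i) = - f i) -> quasi_odd n f.
Proof.
move=> fN fopp; have f0 : f 0 = 0 by have := fopp 0; rewrite oppr0; lra.
by split=> // i; rewrite fN -[N]add0r fN f0 addr0.
Qed.

(** The coordinate along the class of [r], made odd by subtracting the one along the class of
    [- r]. *)
Definition residue_coord (r i : int) : R :=
  (congN n i r)%:R - (congN n i (- r))%:R.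

Lemma residue_coordN r i : residue_coord r (i + N) = residue_coord r i.
Proof. by rewrite /residue_coord -[N]mul1r !congN_shiftl. Qed.

Lemma residue_coord_opp r i : residue_coord r (- i) = - residue_coord r i.
Proof. by rewrite /residue_coord congN_opp -[r in congN n (- i) r]opprK congN_opp opprB. Qed.

Lemma residue_coord_root i j : root_index n i j ->
  residue_coord j i < residue_coord j j.
Proof.
move=> /root_indexP[_ jN /negPf ij].
by rewrite /residue_coord congNxx congN_oppr (negPf jN) ij; case: congN => /=; lra.
Qed.

Lemma relation_functional (I : finType) (a : I -> R) (i j : I -> int) f :
  quasi_odd n f -> \sum_t a t *: (e (j t) - e (i t)) = 0 ->
  \sum_t a t * (f (j t) - f (i t)) = 0.
Proof.
move=> /quasi_odd_functional[L Le] /(congr1 L); rewrite linear0 linear_sum.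
by move=> sum0; rewrite -[RHS]sum0; apply: eq_bigr => t _; rewrite linearZ linearB !Le.
Qed.

Lemma root_functional f i j k l : quasi_odd n f ->
  e j - e i = e l - e k -> f j - f i = f l - f k :> R.
Proof.
by move=> /quasi_odd_functional[L Le] /(congr1 L); rewrite !linearB !Le.
Qed.

(** The functional [i |-> i] gives [l - k = j - i]. The coordinate along [j] is positive on the
    root, which forces [l] congruent to [j] or [k] congruent to [- j]. *)
Lemma root_inj i j k l : root_index n i j -> e j - e i = e l - e k ->
  exists m, k = i + m * N /\ l = j + m * N \/ k = - j + m * N /\ l = - i + m * N.
Proof.
move=> ij ee.
have /eqP := root_functional quasi_odd_intr ee.
rewrite -!intrB eqr_int => /eqP dE.
have := root_functional (quasi_odd_invariant (residue_coordN j) (residue_coord_opp j)) ee.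
have := residue_coord_root ij; rewrite /residue_coord.
have [/congNP[m jE] _ _|_] := boolP (congN n l j).
  by exists (- m); left; rewrite jE; split; [move: dE; rewrite jE => dE|]; lia.
have [/congNP[m jE] _ _|_] := boolP (congN n k (- j)).
  exists (- m); right; split; lia.
by case: (congN n l _); case: (congN n k _) => /=; lra.
Qed.

Lemma et_shift k i : e (i + k * N) = e i + k%:~R *: e N.
Proof.
have kN (m : nat) j : e (j + m%:Z * N) = e j + m%:R *: e N.
  elim: m => [|m IH]; first by rewrite mul0r scale0r !addr0.
  rewrite (_ : j + m.+1%:Z * N = j + m%:Z * N + N); last by rewrite intS; ring.
  by rewrite etDN IH -natr1 scalerDl scale1r addrA.
case: k => m; first exact: kN.
rewrite NegzE -[in RHS](subrK (m.+1%:Z * N) i) kN -addrA mulNr -scalerDl.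
by rewrite mulrNz addrN scale0r addr0.
Qed.

End RootRelations.

(** * Invariant orders *)

Section InvariantOrder.

Variables (n : nat) (prec : rel int).
Hypothesis prec_inv : invariant_order n prec.
Local Notation N := (modN n).
Local Notation "i ≺ j" := (prec i j) (at level 70).

Lemma precxx i : i ≺ i = false.
Proof. by case: prec_inv => -[]. Qed.

Lemma prec_trans j i k : i ≺ j -> j ≺ k -> i ≺ k.
Proof. by case: prec_inv => -[_ + _] _ _; apply. Qed.

Lemma prec_asym i j : i ≺ j -> j ≺ i = false.
Proof. by move=> ij; apply/negP => /(prec_trans ij); rewrite precxx. Qed.

Lemma precNge i j : i != j -> ~~ (i ≺ j) = (j ≺ i).
Proof.
move=> ij; case: prec_inv => -[_ _ /(_ _ _ ij)/orP[ij'|ji] _ _].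
  by rewrite ij' (prec_asym ij').
by rewrite ji (prec_asym ji).
Qed.

Lemma le_prec_trans j i k : ~~ (j ≺ i) -> j ≺ k -> i ≺ k.
Proof.
have [->//|ji] := eqVneq j i.
by rewrite precNge//; apply: prec_trans.
Qed.

Lemma prec_opp i j : (- j ≺ - i) = (i ≺ j).
Proof.
case: prec_inv => _ _ opp; apply/idP/idP => [/opp|/opp//].
by rewrite !opprK.
Qed.

Lemma prec_shift k i j : (i + k * N ≺ j + k * N) = (i ≺ j).
Proof.
pose g k := i + k * N ≺ j + k * N.
suff gS l : g (l + 1) = g l.
  rewrite -/(g k); elim/int_ind: k => [|k <-|k <-].
  - by rewrite /g !mul0r !addr0.
  - by rewrite -[RHS]gS; congr g; rewrite intS; ring.
  - by rewrite -[LHS]gS; congr g; rewrite intS; ring.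
have E a : a + (l + 1) * N = a + l * N + N by ring.
rewrite /g !E; move: (i + _) (j + _) => x y.
case: prec_inv => _ shift _.
apply/idP/idP => [xy|]; last exact: shift.
have [yx|/precNge] := eqVneq x y; first by rewrite yx precxx in xy.
by case: (x ≺ y) => // /esym/shift/(prec_trans xy); rewrite precxx.
Qed.

Definition ascending i := i ≺ i + N.

Lemma ascendingP i k l : ascending i -> (i + k * N ≺ i + l * N) = (k < l).
Proof.
move=> up.
have step m : i ≺ i + m.+1%:Z * N.
  elim: m => [|m /prec_trans]; first by rewrite mul1r.
  apply; rewrite (_ : i + m.+2%:Z * N = i + N + m.+1%:Z * N) ?prec_shift//.
  by rewrite [m.+2%:Z]intS; ring.
have lt a b : a < b -> i + a * N ≺ i + b * N.
  move=> ab; rewrite -(prec_shift (- a)).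
  rewrite (_ : _ + - a * N = i); last by ring.
  rewrite (_ : _ + - a * N = i + (`|b - a|.-1).+1%:Z * N)//.
  by rewrite (_ : _%:Z = b - a); [ring|lia].
case: (ltgtP k l) => [/lt//|/lt/prec_asym//|->]; exact: precxx.
Qed.

End InvariantOrder.

(** By negation invariance this is the opposite order; it exchanges ascending and descending
    classes, so that only ascending ones need a direct treatment. *)
Lemma invariant_order_opp n prec : invariant_order n prec ->
  invariant_order n (fun i j => prec (- i) (- j)).
Proof.
move=> hp; split; first split.
- by move=> i; apply: precxx hp _.
- by move=> j i k; apply: prec_trans hp _ _ _.
- by move=> i j ij; case: hp => -[_ _ tot] _ _; apply: tot; rewrite eqr_opp.
- by move=> i j ij; rewrite -(prec_shift hp 1) mul1r !opprD !subrK.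
- by move=> i j ij; rewrite (prec_opp hp).
Qed.

Lemma descendingP n prec i k l : invariant_order n prec ->
  ~~ ascending n prec i -> prec (i + k * modN n) (i + l * modN n) = (l < k).
Proof.
move=> hp down; have hp' := invariant_order_opp hp.
have up' : ascending n (fun i j => prec (- i) (- j)) (- i).
  rewrite /ascending opprK opprD opprK -(prec_shift hp 1) mul1r subrK.
  by rewrite -(precNge hp)//; have := modN_gt0 n; lia.
have := ascendingP hp' (- k) (- l) up'.
by rewrite ltrN2 => <-; congr prec; ring.
Qed.

(** * Inversion sets are biclosed *)

Lemma ord3_cover (t u v s : 'I_3) : t != u -> t != v -> u != v ->
  [|| s == t, s == u | s == v].
Proof. by case: t u v s => [[|[|[|//]]] ?] [[|[|[|//]]] ?] [[|[|[|//]]] ?] [[|[|[|//]]] ?]. Qed.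

Section NoPositiveRelation.

Variables (R : realType) (n : nat) (prec : rel int).
Hypothesis hp : invariant_order n prec.
Local Notation N := (modN n).
Local Notation e := (et R n).
Local Notation "i ≺ j" := (prec i j) (at level 70).

Variables (a : 'I_3 -> R) (i j : 'I_3 -> int).
Hypothesis ij_root : forall t, root_index n (i t) (j t).
Hypothesis a_gt0 : forall t, 0 < a t.
Hypothesis ij_prec : forall t, i t ≺ j t.
Hypothesis relation : \sum_t a t *: (e (j t) - e (i t)) = 0.

(** Applied to the relation, [f] gives a vanishing sum of nonnegative terms, so each term
    vanishes. *)
Lemma tight_functional (f : int -> R) : quasi_odd n f ->
  (forall t, f (i t) <= f (j t)) -> forall t, f (i t) = f (j t).
Proof.
move=> fo fij t; have := relation_functional fo relation.
move=> /psumr_eq0P s0; apply/esym/eqP; rewrite -subr_eq0.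
have /eqP : a t * (f (j t) - f (i t)) = 0.
  by apply: s0 => // u _; rewrite mulr_ge0 ?subr_ge0// ltW.
by rewrite mulf_eq0 gt_eqF.
Qed.

(** The function [[g y] - [g (- y)]] is quasi-odd and weakly increasing along the edges. Tightness
    makes the sum of two nonnegative increments zero, so both are zero. *)
Lemma tight_predicate (g : int -> bool) :
  (forall y, g (y + N) = g y) -> (forall x y, x ≺ y -> g x -> g y) ->
  forall t, g (i t) = g (j t) /\ g (- i t) = g (- j t).
Proof.
move=> gN gmono t.
have gN' y : g (- (y + N)) = g (- y) by rewrite -gN opprD subrK.
pose f y : R := (g y)%:R - (g (- y))%:R.
have /tight_functional tight : quasi_odd n f.
  by apply: quasi_odd_invariant => y; rewrite /f ?gN ?gN' ?opprK ?opprB.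
have := tight _ t; rewrite /f.
have edge u : (g (i u) ==> g (j u)) && (g (- j u) ==> g (- i u)).
  apply/andP; split; apply/implyP; apply: gmono => //.
  by rewrite (prec_opp hp).
move=> /(_ _) tE; have : f (i t) = f (j t).
  apply: tE => u; rewrite /f; have /andP[] := edge u.
  by case: (g (i u)); case: (g (j u)); case: (g (- i u)); case: (g (- j u)) => //= _ _; lra.
rewrite /f; have /andP[] := edge t.
by case: (g (i t)); case: (g (j t)); case: (g (- i t)); case: (g (- j t)) => //= _ _; lra.
Qed.

(** If [t] were the only edge in [Q], the coordinate along [j t], cut off outside [Q], would be a
    functional under which only the term of [t] survives, and that term is positive. *)
Lemma not_isolated (Q : int -> bool) (t : 'I_3) :
  (forall y, Q (y + N) = Q y) -> (forall y, Q (- y) = Q y) ->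
  (forall s, Q (i s) = Q (j s)) -> Q (j t) ->
  exists2 s, s != t & Q (j s).
Proof.
move=> QN Qopp Qij Qt; apply: contrapT => isol.
have Qs s : s != t -> Q (j s) = false.
  by move=> st; apply/negP => Qs; apply: isol; exists s.
pose f y : R := (Q y)%:R * residue_coord R n (j t) y.
have fo : quasi_odd n f.
  apply: quasi_odd_invariant => y; rewrite /f ?QN ?Qopp ?residue_coordN//.
  by rewrite residue_coord_opp mulrN.
have := relation_functional fo relation.
rewrite (bigD1 t)//= big1 ?addr0 => [|s st].
  rewrite /f Qij Qt !mul1r => /eqP; rewrite mulf_eq0 gt_eqF//= subr_eq0.
  by rewrite gt_eqF// residue_coord_root.
by rewrite /f Qij Qs// !mul0r subrr mulr0.
Qed.

(** * Residues interlaced with an ascending base point *)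

Section Ascending.

Variable t0 : 'I_3.
Local Notation x := (j t0).
Hypothesis x_up : ascending n prec x.

(** Some translate of [x] weakly precedes [y]; together with [below], this makes [linked] mean lying
    between two translates of [x]. *)
Definition above y := `[< exists k, ~~ (y ≺ x + k * N) >].
Definition below y := `[< exists k, y ≺ x + k * N >].
Definition linked y := above y && below y.

Lemma aboveN y : above (y + N) = above y.
Proof.
apply/asboolP/asboolP => -[k yk].
  by exists (k - 1); rewrite -(prec_shift hp 1) mulrBl !mul1r -addrA subrK.
by exists (k + 1); rewrite mulrDl addrA -[X in y + X]mul1r (prec_shift hp).
Qed.

Lemma belowN y : below (y + N) = below y.
Proof.
apply/asboolP/asboolP => -[k yk].
  by exists (k - 1); rewrite -(prec_shift hp 1) mulrBl !mul1r -addrA subrK.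
by exists (k + 1); rewrite mulrDl addrA -[X in y + X]mul1r (prec_shift hp).
Qed.

Lemma linkedN y : linked (y + N) = linked y.
Proof. by rewrite /linked aboveN belowN. Qed.

Lemma linked_oppN y : linked (- (y + N)) = linked (- y).
Proof. by rewrite -linkedN opprD subrK. Qed.

(** Both [above] and the complement of [below] are translation invariant upper sets. *)
Lemma linked_edge t :
  linked (i t) = linked (j t) /\ linked (- i t) = linked (- j t).
Proof.
have above_mono u v : u ≺ v -> above u -> above v.
  move=> uv /asboolP[k ku]; apply/asboolP; exists k.
  by apply: contra ku; apply: (prec_trans hp).
have below_mono u v : u ≺ v -> ~~ below u -> ~~ below v.
  move=> uv; apply: contra => /asboolP[k vk]; apply/asboolP; exists k.
  exact: (prec_trans hp uv vk).
have [a1 a2] := tight_predicate aboveN above_mono t.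
have [] := tight_predicate (fun y => congr1 negb (belowN y)) below_mono t.
by rewrite /linked a1 a2 => /negb_inj-> /negb_inj->.
Qed.

Lemma linked_base : linked x.
Proof.
apply/andP; split; apply/asboolP.
  by exists 0; rewrite mul0r addr0 (precxx hp).
by exists 1; rewrite mul1r.
Qed.

(** Neither the edges in [Q] nor those outside [Q] can consist of a single edge. With edge [t0] in
    [Q] and [t] outside, each side would need a second edge, four in all. *)
Lemma linked_all t : linked (j t) || linked (- j t).
Proof.
pose Q y := linked y || linked (- y).
have QN y : Q (y + N) = Q y by rewrite /Q linkedN linked_oppN.
have Qopp y : Q (- y) = Q y by rewrite /Q opprK orbC.
have Qe s : Q (i s) = Q (j s) by rewrite /Q; have [-> ->] := linked_edge s.
have Qt0 : Q (j t0) by rewrite /Q linked_base.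
rewrite -/(Q (j t)); apply/negPn/negP => Qt.
have [s st0 Qs] := not_isolated QN Qopp Qe Qt0.
have [|||u ut Qu] := @not_isolated (fun y => ~~ Q y) t _ _ _ Qt.
- by move=> y; rewrite QN.
- by move=> y; rewrite Qopp.
- by move=> y; rewrite Qe.
have /or3P[] : [|| u == t0, u == t | u == s].
  apply: ord3_cover; rewrite ?[_ == s]eq_sym//.
  - by apply: contra Qt => /eqP<-.
  - by apply: contra Qt => /eqP<-.
- by move=> /eqP uE; rewrite uE Qt0 in Qu.
- by rewrite (negPf ut).
- by move=> /eqP uE; rewrite uE Qs in Qu.
Qed.

(** [x + k * N] is the last translate of [x] weakly preceding [y]. *)
Definition level_spec y k := ~~ (y ≺ x + k * N) && (y ≺ x + (k + 1) * N).

Lemma level_exists y : linked y -> exists k, level_spec y k.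
Proof.
move=> /andP[/asboolP[k ky] /asboolP[l yl]].
have kl : k < l by rewrite -(ascendingP hp _ _ x_up); exact: (le_prec_trans hp ky yl).
have : exists m : nat, y ≺ x + (k + m%:Z) * N.
  by exists `|l - k|%N; rewrite (_ : k + _ = l) //; lia.
move=> /ex_minnP[[|m] ym min]; first by rewrite addr0 (negPf ky) in ym.
exists (k + m%:Z); apply/andP; split; last by rewrite -addrA -[1]/(1%:Z) -PoszD addn1.
by apply/negP => /min; rewrite ltnn.
Qed.

Lemma level_mono y z k l : level_spec y k -> level_spec z l ->
  ~~ (z ≺ y) -> k <= l.
Proof.
move=> /andP[ky _] /andP[_ zl] yz; rewrite -ltzD1 -(ascendingP hp _ _ x_up).
exact: (le_prec_trans hp ky (le_prec_trans hp yz zl)).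
Qed.

Lemma no_ascending_relation : False.
Proof.
have /choice[h hP] y : exists k, linked y -> level_spec y k.
  have [/level_exists[k ky]|ny] := boolP (linked y); first by exists k.
  by exists 0.
have hmono y z : linked y -> linked z -> ~~ (z ≺ y) -> h y <= h z.
  by move=> ly lz; apply: level_mono; apply: hP.
have hN y : linked y -> h (y + N) = h y + 1.
  move=> ly; have lyN : linked (y + N) by rewrite linkedN.
  have sN : level_spec (y + N) (h y + 1).
    have := hP _ ly; rewrite /level_spec -!(prec_shift hp 1 y).
    by rewrite !mul1r !mulrDl !mul1r !addrA.
  by apply/eqP; rewrite eq_le !(level_mono (y := y + N) (z := y + N)) ?(precxx hp) ?sN ?hP.
(* Oddness requires combining the levels [h y] and [- h (- y)]: their average if both exist,
   otherwise the one that does. The value [y / N] is a filler that keeps [H (y + N) = H y + 1]; by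
   [linked_all] it never occurs on an edge. *)
pose H y : R := if linked y then
    if linked (- y) then ((h y)%:~R - (h (- y))%:~R) / 2 else (h y)%:~R
  else if linked (- y) then - (h (- y))%:~R else y%:~R / N%:~R.
have N0 : N%:~R != 0 :> R by rewrite intr_eq0.
have HN1 y : H (y + N) = H y + 1.
  rewrite /H linkedN linked_oppN.
  have hoppN : linked (- y) -> h (- (y + N)) = h (- y) - 1.
    by move=> ly; rewrite -[in RHS](subrK N (- y)) -opprD hN ?addrK// opprD -linkedN subrK.
  case: ifP => [/hN->|_]; case: ifP => [/hoppN->|_];
    rewrite !(rmorphD, rmorphB, rmorphN) /=; try lra.
  by rewrite mulrDl divff.
have Hopp y : H (- y) = - H y.
  rewrite /H opprK; case: ifP => _; case: ifP => _; rewrite ?rmorphN ?mulNr //=; lra.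
have H0 : H 0 = 0 by have := Hopp 0; rewrite oppr0; lra.
have Ho : quasi_odd n H by split=> // y; rewrite HN1 -[N]add0r HN1 H0 add0r.
have hij t : linked (j t) -> (h (i t))%:~R <= (h (j t))%:~R :> R.
  move=> lj; have [li _] := linked_edge t.
  by rewrite ler_int; apply: hmono; rewrite ?li// (prec_asym hp).
have hji t : linked (- j t) -> (h (- j t))%:~R <= (h (- i t))%:~R :> R.
  move=> lj; have [_ li] := linked_edge t.
  by rewrite ler_int; apply: hmono; rewrite ?li// (prec_opp hp) (prec_asym hp).
have H_le t : H (i t) <= H (j t).
  rewrite /H; have [-> ->] := linked_edge t.
  case: (linked (j t)) (linked (- j t)) (linked_all t) (hij t) (hji t) => -[] //= _ A B;
    try (have {}A := A isT); try (have {}B := B isT); lra.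
have := tight_functional Ho H_le t0; have := hji t0; rewrite /H.
have hP0 := hP _ linked_base; have [li ->] := linked_edge t0.
have hPi : level_spec (i t0) (h (i t0)) by apply: hP; rewrite li linked_base.
rewrite li linked_base.
(* Strictness at [t0]: [x] has level at least 0 as it weakly follows itself, while [i t0 ≺ x] puts
   [i t0] at a negative level. *)
have hx : 0 <= h x.
  apply: (level_mono (y := x) (z := x) _ hP0); last by rewrite (precxx hp).
  by rewrite /level_spec mul0r addr0 (precxx hp) add0r mul1r.
have hi0 : h (i t0) < 0.
  have /andP[hi _] := hPi; rewrite -(ascendingP hp _ _ x_up) mul0r addr0.
  exact: (le_prec_trans hp hi (ij_prec t0)).
have {hi0}: (h (i t0))%:~R < (h x)%:~R :> R by rewrite ltr_int; exact: lt_le_trans hx.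
by case: linked => [hlt /(_ isT)|]; lra.
Qed.

End Ascending.

End NoPositiveRelation.

(** If the class of the base point descends, negating all indices and passing to the opposite order
    negates the relation and makes that class ascend. *)
Lemma no_positive_relation (R : realType) n prec (a : 'I_3 -> R) i j :
    invariant_order n prec ->
    (forall t, root_index n (i t) (j t)) -> (forall t, 0 < a t) ->
    (forall t, prec (i t) (j t)) ->
  \sum_t a t *: (et R n (j t) - et R n (i t)) <> 0.
Proof.
move=> hp ij_root a_gt0 ij_prec rel0.
have [up|down] := boolP (ascending n prec (j ord0)).
  exact: (no_ascending_relation hp ij_root a_gt0 ij_prec rel0 up).
pose prec' x y := prec (- x) (- y).
have hp' : invariant_order n prec' := invariant_order_opp hp.
apply: (@no_ascending_relation _ _ _ hp' a (fun t => - i t) (fun t => - j t)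
  _ a_gt0 _ _ ord0).
- move=> t; have /root_indexP[iN jN ij] := ij_root t.
  by apply/root_indexP; rewrite congN_opp !rpredN.
- by move=> t; rewrite /prec' !opprK.
- apply: etrans (_ : - (\sum_t a t *: (et R n (j t) - et R n (i t))) = 0);
    last by rewrite rel0 oppr0.
  rewrite -sumrN; apply: eq_bigr => t _.
  by rewrite !etN -scalerN -opprD.
- have := descendingP 0 (-1) hp down.
  by rewrite mul0r addr0 mulN1r /ascending /prec' opprD !opprK.
Qed.

(** * Biclosedness from the absence of positive relations *)

Section Inversions.

Variables (R : realType) (n : nat).
Local Notation N := (modN n).
Local Notation e := (et R n).

Lemma root_index_sym i j : root_index n i j -> root_index n j i.
Proof. by move=> /root_indexP[iN jN ij]; apply/root_indexP; rewrite congN_sym. Qed.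

Lemma root_index_neq i j : root_index n i j -> i != j.
Proof. by move=> /root_indexP[_ _]; apply: contra => /eqP->; exact: congNxx. Qed.

Lemma pos_rootsE i j : root_index n i j -> pos_roots R n (e j - e i) <-> i < j.
Proof.
move=> ij; split=> [[k [l [kl lt_kl /root_functional]]]|lt_ij]; last by exists i, j.
by move=> /(_ _ (quasi_odd_intr _ _)); rewrite -!intrB => /intr_inj; lia.
Qed.

(** Two index pairs of one root differ by a translation and possibly by [(i, j) |-> (- j, - i)],
    both of which preserve [prec]. *)
Lemma inversionsE prec i j : invariant_order n prec ->
  root_index n i j -> i < j -> inversions R n prec (e j - e i) <-> prec j i.
Proof.
move=> hp ij lt_ij; split=> [[k [l [kl lt_kl lk /root_inj]]]|ji]; last by exists i, j.
move=> /(_ ij)[m [[kE lE]|[kE lE]]]; first by rewrite kE lE prec_shift in lk.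
by rewrite kE lE (prec_shift hp) (prec_opp hp) in lk.
Qed.

Lemma no_positive_relation3 prec (a b c : R) i1 j1 i2 j2 i3 j3 :
    invariant_order n prec -> 0 < a -> 0 < b -> 0 < c ->
    root_index n i1 j1 -> root_index n i2 j2 -> root_index n i3 j3 ->
    prec i1 j1 -> prec i2 j2 -> prec i3 j3 ->
  a *: (e j1 - e i1) + b *: (e j2 - e i2) + c *: (e j3 - e i3) <> 0.
Proof.
move=> hp a0 b0 c0 r1 r2 r3 p1 p2 p3 rel0.
apply: (@no_positive_relation R n prec (fun t => nth 0 [:: a; b; c] t)
  (fun t => nth 0 [:: i1; i2; i3] t) (fun t => nth 0 [:: j1; j2; j3] t) hp);
  try by case=> -[|[|[|//]]].
by rewrite !big_ord_recl big_ord0 /= addr0 addrA.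
Qed.

(** A failure of either condition, with each root [e j - e i] negated when [j] precedes [i], turns
    [gamma = a alpha + b beta] into a forbidden positive relation. *)
Lemma inversions_biclosed prec :
  invariant_order n prec -> biclosed (inversions R n prec).
Proof.
move=> hp; split=> [v [i [j [ij lt_ij _ ->]]]|]; first by exists i, j.
move=> _ _ _ [i1 [j1 [r1 lt1 ->]]] [i2 [j2 [r2 lt2 ->]]] [i3 [j3 [r3 lt3 ->]]].
move=> [a [b [a0 b0 rel]]].
have opp i j : e i - e j = - (e j - e i) by rewrite opprB.
have [[s1 s2] s3] := (root_index_sym r1, root_index_sym r2, root_index_sym r3).
have [[n1 n2] n3] := (root_index_neq s1, root_index_neq s2, root_index_neq s3).
have [I1 J1] := inversionsE hp r1 lt1; have [I2 J2] := inversionsE hp r2 lt2.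
have [I3 J3] := inversionsE hp r3 lt3.
split=> [/I1 p1 /I2 p2|p1 p2 /I3 p3].
  apply/J3/negPn/negP; rewrite (precNge hp)// => p3.
  apply: (no_positive_relation3 hp a0 b0 ltr01 s1 s2 r3) => //.
  by rewrite (opp i1) (opp i2) !scalerN -opprD -rel scale1r addNr.
have /negP := contra_not J1 p1; have /negP := contra_not J2 p2.
rewrite !(precNge hp)// => {}p2 {}p1.
apply: (no_positive_relation3 hp a0 b0 ltr01 r1 r2 s3) => //.
by rewrite (opp i3) -rel scale1r addrN.
Qed.

End Inversions.

(** * Orienting all roots by a biclosed set *)

Section Sides.

Variables (R : realType) (n : nat) (B : set (Vt R n)).
Hypothesis B_biclosed : biclosed B.
Local Notation N := (modN n).
Local Notation e := (et R n).
Local Notation pos := (pos_roots R n).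

(** When [B] is the inversion set of an order, the root [e j - e i] is on this side exactly when [i]
    precedes [j]. *)
Definition out_side (v : Vt R n) : Prop := (pos v /\ ~ B v) \/ (pos (- v) /\ B (- v)).

Lemma height_functional :
  exists L : {linear Vt R n -> R^o}, forall v, pos v -> 0 < (L v : R).
Proof.
have [L Le] := quasi_odd_functional (quasi_odd_intr R n).
exists L => _ [i [j [_ ij ->]]].
by rewrite linearB !Le subr_gt0 ltr_int.
Qed.

Lemma relation_cone (a b c : R) (u v w : Vt R n) : 0 < a -> 0 < b -> 0 < c ->
  a *: u + b *: v + c *: w = 0 ->
  exists a' b' : R, [/\ 0 < a', 0 < b' & - w = a' *: u + b' *: v].
Proof.
move=> a0 b0 c0 rel; exists (c^-1 * a), (c^-1 * b); split; rewrite ?mulr_gt0 ?invr_gt0//.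
rewrite -!scalerA -scalerDr; apply: (scalerI (lt0r_neq0 c0)).
by rewrite scalerA mulfV ?lt0r_neq0// scale1r scalerN; apply/esym/eqP;
   rewrite -subr_eq0 opprK rel.
Qed.

(** Three roots of the same sign are excluded by the height functional. With mixed signs, the odd
    one out is, up to sign, a positive combination of the other two, against biclosedness; the
    rotated relations bring it to the last place. *)
Lemma out_side_relation (a b c : R) u v w : 0 < a -> 0 < b -> 0 < c ->
  out_side u -> out_side v -> out_side w -> a *: u + b *: v + c *: w <> 0.
Proof.
have two_out (a' b' c' : R) x y z : 0 < a' -> 0 < b' -> 0 < c' ->
    pos x /\ ~ B x -> pos y /\ ~ B y -> pos (- z) /\ B (- z) ->
    a' *: x + b' *: y + c' *: z <> 0.
  move=> a0 b0 c0 [px nx] [py ny] [pz nz] /(relation_cone a0 b0 c0) cone.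
  by have [_ /(_ _ _ _ px py pz cone)[_]] := B_biclosed; apply.
have two_in (a' b' c' : R) x y z : 0 < a' -> 0 < b' -> 0 < c' ->
    pos (- x) /\ B (- x) -> pos (- y) /\ B (- y) -> pos z /\ ~ B z ->
    a' *: x + b' *: y + c' *: z <> 0.
  move=> a0 b0 c0 [px nx] [py ny] [pz nz] rel; apply: nz.
  have : a' *: - x + b' *: - y + c' *: - z = 0 by rewrite !scalerN -!opprD rel oppr0.
  move=> /(relation_cone a0 b0 c0); rewrite opprK => cone.
  by have [_ /(_ _ _ _ px py pz cone)[+ _]] := B_biclosed; apply.
have [L Lpos] := height_functional.
move=> a0 b0 c0 pu pv pw rel.
have relA : c *: w + a *: u + b *: v = 0 by rewrite -addrA addrC.
have relC : b *: v + c *: w + a *: u = 0 by rewrite addrC addrA.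
have relL : a * L u + b * L v + c * L w = 0.
  by have := congr1 L rel; rewrite !linearD !linearZ linear0.
case: pu pv pw => pu [] pv [] pw.
- by case: pu pv pw => /Lpos ? _ [/Lpos ? _] [/Lpos ? _]; nra.
- exact: two_out rel.
- exact: two_out relA.
- exact: two_in relC.
- exact: two_out relC.
- exact: two_in relA.
- exact: two_in rel.
case: pu pv pw => /Lpos + _ [/Lpos + _] [/Lpos + _].
by rewrite !linearN /= => ? ? ?; nra.
Qed.

Lemma out_side_total i j : root_index n i j ->
  out_side (e j - e i) \/ out_side (e i - e j).
Proof.
move=> ij; rewrite /out_side !opprB.
have [lt_ij|lt_ji|ji] := ltgtP i j; last by move/root_index_neq: ij; rewrite ji eqxx.
  have pij : pos (e j - e i) by apply/pos_rootsE.
  by have [|] := pselect (B (e j - e i)); tauto.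
have pji : pos (e i - e j) by apply/pos_rootsE => //; apply: root_index_sym.
by have [|] := pselect (B (e i - e j)); tauto.
Qed.

End Sides.

(** * The order attached to a biclosed set *)

Section Arrow.

Variables (R : realType) (n : nat) (B : set (Vt R n)).
Hypothesis B_biclosed : biclosed B.
Local Notation N := (modN n).
Local Notation e := (et R n).

(** If just one of [i], [j] is a multiple of [N], then [e j - e i] has to be doubled to become a
    root. *)
Definition ray_scale (i j : int) : R :=
  if (N %| i)%Z || (N %| j)%Z then 2 else 1.

Definition ray_root i j := ray_scale i j *: (e j - e i).

Definition arrow : rel int := fun i j => `[< out_side B (ray_root i j) >].

Lemma ray_scale_gt0 i j : 0 < ray_scale i j.
Proof. by rewrite /ray_scale; case: ifP; lra. Qed.

Lemma ray_rootC i j : ray_root j i = - ray_root i j.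
Proof. by rewrite /ray_root /ray_scale orbC -scalerN opprB. Qed.

Lemma et0 : e 0 = 0.
Proof. by apply: (addIr (e N)); rewrite -etDN !add0r. Qed.

Lemma ray_root_shift k i j : ray_root (i + k * N) (j + k * N) = ray_root i j.
Proof.
by rewrite /ray_root /ray_scale !congN0 !congN_shiftr !et_shift opprD addrACA subrr addr0.
Qed.

Lemma ray_root_opp i j : ray_root (- j) (- i) = ray_root i j.
Proof. by rewrite /ray_root /ray_scale !rpredN orbC !etN opprK addrC. Qed.

Lemma ray_root_is_root i j : ~~ congN n i j ->
  exists k l, root_index n k l /\ ray_root i j = e l - e k.
Proof.
have zero_l p q : (N %| p)%Z -> ~~ congN n p q ->
    exists k l, root_index n k l /\ ray_root p q = e l - e k.
  rewrite /ray_root /ray_scale congN0 => p0; rewrite p0 -(congN_transl _ p0) -congN0 => qN.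
  (* The first index is [2 p - q], the reflection of [q] in [p = m * N]. *)
  move: p0 => /congNP[m ->]; exists (- q + (m + m) * N), q; split.
    apply/root_indexP; rewrite congN_shiftl congN_oppxx; split=> //.
    by rewrite congN0 congN_shiftr -congN0 rpredN.
  rewrite scaler_nat mulr2n !et_shift etN et0 add0r opprD opprK.
  by rewrite rmorphD scalerDl /= opprD addrACA !addrA.
move=> ij; have [i0|i0] := boolP (N %| i)%Z; first exact: zero_l.
have [j0|j0] := boolP (N %| j)%Z.
  have [|k [l [kl E]]] := zero_l j i j0; first by rewrite congN_sym.
  by exists l, k; split; [exact: root_index_sym|rewrite ray_rootC E opprB].
exists i, j; split; first by apply/root_indexP.
by rewrite /ray_root /ray_scale (negPf i0) (negPf j0) scale1r.
Qed.

Lemma arrow_shift k i j : arrow (i + k * N) (j + k * N) = arrow i j.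
Proof. by rewrite /arrow ray_root_shift. Qed.

Lemma arrow_opp i j : arrow (- j) (- i) = arrow i j.
Proof. by rewrite /arrow ray_root_opp. Qed.

Lemma arrow_total i j : ~~ congN n i j -> arrow i j || arrow j i.
Proof.
move=> /ray_root_is_root[k [l [kl E]]]; rewrite /arrow (ray_rootC i j) E opprB.
by have [?|?] := out_side_total B kl; apply/orP; [left|right]; apply/asboolP.
Qed.

Lemma arrow_relation (a b c : R) i1 j1 i2 j2 i3 j3 : 0 < a -> 0 < b -> 0 < c ->
  arrow i1 j1 -> arrow i2 j2 -> arrow i3 j3 ->
  a *: (e j1 - e i1) + b *: (e j2 - e i2) + c *: (e j3 - e i3) <> 0.
Proof.
have unscale (x : R) i j : x *: (e j - e i) = (x / ray_scale i j) *: ray_root i j.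
  by rewrite scalerA divfK// gt_eqF// ray_scale_gt0.
move=> a0 b0 c0 /asboolP u /asboolP v /asboolP w; rewrite !unscale.
by apply: (out_side_relation B_biclosed) => //; rewrite divr_gt0// ray_scale_gt0.
Qed.

Lemma arrow_acyclic i j k : arrow i j -> arrow j k -> arrow k i -> False.
Proof.
move=> ij jk ki; apply: (arrow_relation ltr01 ltr01 ltr01 ij jk ki).
by rewrite !scale1r [_ + (e k - _)]addrC !addrA !subrK subrr.
Qed.

(** The arrow [i j] is used twice, with coefficients 1, 1, 2, to fit the three-term form. *)
Lemma arrow_asym i j : arrow i j -> arrow j i -> False.
Proof.
move=> ij ji; apply: (@arrow_relation 1 1 2 _ _ _ _ _ _ _ _ _ ij ij ji) => //.
by rewrite -scalerDl -[e i - e j]opprB scalerN subrr.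
Qed.

(** [e (j + l * N)] is the average of [e (j + k * N)] and [e (j + m * N)] with weights proportional
    to [m - l] and [l - k]. *)
Lemma arrow_convex i j k l m : k < l -> l < m ->
  arrow i (j + k * N) -> arrow i (j + m * N) -> arrow (j + l * N) i -> False.
Proof.
move=> kl lm ik im li.
have [a0 b0 c0] : [/\ 0 < (m - l)%:~R :> R, 0 < (l - k)%:~R :> R & 0 < (m - k)%:~R :> R].
  by rewrite !ltr0z; split; lia.
apply: (arrow_relation a0 b0 c0 ik im li); rewrite !et_shift.
rewrite -[e i - _]opprB ![e j + _ - _]addrAC; move: (e j - e i) (e N) => u d.
rewrite scalerN !scalerDr !scalerA opprD [X in X + _ = _]addrACA.
rewrite [LHS]addrACA -!scalerDl -!scalerBl.
rewrite -!intrM -!intrD -!intrB.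
have -> : m - l + (l - k) - (m - k) = 0 by ring.
have -> : (m - l) * k + (l - k) * m - (m - k) * l = 0 by ring.
by rewrite !scale0r addr0.
Qed.

End Arrow.

(** * From an acyclic convex orientation to a total order *)

Section OrderOfArrow.

Variables (n : nat) (arrow : rel int).
Local Notation N := (modN n).
Local Notation "i ~~N j" := (congN n i j) (at level 70).
Local Notation "i --> j" := (arrow i j) (at level 70).
Hypothesis shift : forall k i j, (i + k * N --> j + k * N) = (i --> j).
Hypothesis opp : forall i j, (- j --> - i) = (i --> j).
Hypothesis total : forall i j, ~~ (i ~~N j) -> (i --> j) || (j --> i).
Hypothesis asym : forall i j, i --> j -> j --> i -> False.
Hypothesis acyclic : forall i j k, i --> j -> j --> k -> k --> i -> False.
Hypothesis convex : forall i j k l m, k < l -> l < m ->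
  i --> j + k * N -> i --> j + m * N -> j + l * N --> i -> False.

Lemma convex_opp i j k l m : k < l -> l < m ->
  j + k * N --> i -> j + m * N --> i -> i --> j + l * N -> False.
Proof.
move=> kl lm ki mi il; apply: (@convex (- i) (- j) (- m) (- l) (- k));
  by rewrite ?ltrN2// -opp opprK opprD opprK mulNr opprK.
Qed.

Lemma arrow_trans i j k : ~~ (i ~~N k) -> i --> j -> j --> k -> i --> k.
Proof. by move=> /total/orP[//|ki] ij jk; have := acyclic ij jk ki. Qed.

(** Translating the second arrow by [(k - l) * N] gives [i --> j + k * N --> i + (k - l) * N], so
    [i] must precede a smaller element of its class. A class without such a witness is ordered
    increasingly by default. *)
Definition descends i := `[< exists j k l,
  [/\ ~~ (i ~~N j), k < l, i --> j + k * N & j + l * N --> i] >].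

(** Witnesses for both directions in one class contradict convexity or asymmetry. In distinct
    classes of [j] and [j'], convexity extends the arrows to whole tails, and going through [i] then
    relates [j + l * N] and [j' + l' * N] both ways. *)
Lemma not_descends i j k l : ~~ (i ~~N j) -> k < l ->
  j + k * N --> i -> i --> j + l * N -> ~~ descends i.
Proof.
move=> ij kl jki ijl; apply/negP => /asboolP[j' [k' [l' [ij' kl' ijk' jli']]]].
have [/congNP[p jE]|jj'] := boolP (j ~~N j').
  move: ijk' jli'; rewrite jE -!addrA -!mulrDl => ia bi.
  have [lb|bl|lb] := ltgtP l (p + l').
  - exact: convex_opp kl lb jki bi ijl.
  - by apply: (convex (k := p + k') _ bl ia ijl bi); rewrite ltrD2l.
  - by apply: (asym ijl); rewrite lb.
have ijm m : l <= m -> i --> j + m * N.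
  rewrite le_eqVlt => /predU1P[<-//|lm].
  have /total/orP[//|mi] : ~~ (i ~~N j + m * N) by rewrite congN_shiftr.
  by case: (convex_opp kl lm jki mi ijl).
have jmi m : m <= k -> j + m * N --> i.
  rewrite le_eqVlt => /predU1P[->//|mk].
  have /total/orP[im|//] : ~~ (i ~~N j + m * N) by rewrite congN_shiftr.
  by case: (convex mk kl im ijl jki).
have ijm' m : m <= k' -> i --> j' + m * N.
  rewrite le_eqVlt => /predU1P[->//|mk].
  have /total/orP[//|mi] : ~~ (i ~~N j' + m * N) by rewrite congN_shiftr.
  by case: (convex_opp mk kl' mi jli' ijk').
have jmi' m : l' <= m -> j' + m * N --> i.
  rewrite le_eqVlt => /predU1P[<-//|lm].
  have /total/orP[im|//] : ~~ (i ~~N j' + m * N) by rewrite congN_shiftr.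
  by case: (convex kl' lm ijk' im jli').
have jj'l : j + l * N --> j' + l' * N.
  (* Lowering both points by [d] translates puts the first before [i] and the second after [i]. *)
  pose d := (l - k) + (l' - k').
  rewrite -(shift (- d)) -!addrA -!mulrDl; apply: (@arrow_trans _ i).
  - by rewrite congN_shiftl congN_shiftr.
  - by apply: jmi; rewrite /d; lia.
  - by apply: ijm'; rewrite /d; lia.
apply: (asym jj'l); apply: (@arrow_trans _ i).
- by rewrite congN_shiftl congN_shiftr congN_sym.
- exact: jmi'.
- exact: ijm.
Qed.

Lemma descends_shift k i : descends (i + k * N) = descends i.
Proof.
suff imp a x : descends x -> descends (x + a * N).
  apply/idP/idP => [/(imp (- k))|]; last exact: imp.
  by rewrite mulNr addrK.
move=> /asboolP[j [l [m [ij lm il mi]]]]; apply/asboolP.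
exists (j + a * N), l, m; split=> //; first by rewrite congN_shiftl congN_shiftr.
  by rewrite addrAC shift.
by rewrite addrAC shift.
Qed.

Lemma descends_opp i : descends (- i) = descends i.
Proof.
suff imp x : descends x -> descends (- x).
  by apply/idP/idP => [/imp|/imp//]; rewrite opprK.
move=> /asboolP[j [l [m [ij lm il mi]]]]; apply/asboolP.
exists (- j), (- m), (- l); split=> //; first by rewrite congN_opp.
- by rewrite ltrN2.
- by rewrite mulNr -opprD opp.
- by rewrite mulNr -opprD opp.
Qed.

Definition arrow_order : rel int := fun i j =>
  if i ~~N j then (if descends i then j < i else i < j) else i --> j.

Lemma descends_congN i j : i ~~N j -> descends i = descends j.
Proof. by move=> /congNP[k ->]; rewrite descends_shift. Qed.

Lemma arrow_order_shift k i j : arrow_order (i + k * N) (j + k * N) = arrow_order i j.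
Proof.
by rewrite /arrow_order congN_shiftl congN_shiftr descends_shift shift !ltrD2r.
Qed.

Lemma arrow_order_opp i j : arrow_order (- j) (- i) = arrow_order i j.
Proof.
rewrite /arrow_order congN_opp congN_sym opp descends_opp !ltrN2.
by case: ifP => // /descends_congN->.
Qed.

Lemma arrow_order_irr : irreflexive arrow_order.
Proof. by move=> i; rewrite /arrow_order congNxx ltxx if_same. Qed.

Lemma arrow_order_total i j : i != j -> arrow_order i j || arrow_order j i.
Proof.
move=> ij; rewrite /arrow_order [j ~~N i]congN_sym.
case: ifP => [/descends_congN->|/negbT/total//].
by case: ifP; lia.
Qed.

(** Otherwise [j --> i] and [i --> j - m * N], and this pair forces the class of [i] to run in the
    direction opposite to the one assumed. *)
Lemma arrow_order_step i j m : ~~ (i ~~N j) ->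
  arrow_order i (i + m * N) -> i + m * N --> j -> i --> j.
Proof.
move=> ij; rewrite /arrow_order congN_shift => im mj.
have /orP[//|ji] := total ij.
have imj : i --> j + (- m) * N by rewrite -(shift m) mulNr subrK.
have jE : j + 0 * N = j by rewrite mul0r addr0.
move: im; case: ifP => [|/negP] di im.
  have m0 : 0 < - m by have := modN_gt0 n; move: (N) im => M; nia.
  by have := @not_descends i j 0 (- m) ij m0; rewrite jE di => /(_ ji imj).
have m0 : - m < 0 by have := modN_gt0 n; move: (N) im => M; nia.
case: di; apply/asboolP; exists j, (- m), 0; split=> //.
by rewrite jE.
Qed.

Lemma arrow_order_trans : transitive arrow_order.
Proof.
have left i j k : i ~~N j -> ~~ (i ~~N k) ->
    arrow_order i j -> arrow_order j k -> arrow_order i k.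
  move=> /congNP[m ->] ik ij; rewrite /arrow_order congN_shiftl (negPf ik).
  exact: arrow_order_step.
move=> j i k ij jk.
have [ij_c|ij_c] := boolP (i ~~N j); have [ik_c|ik_c] := boolP (i ~~N k).
- move: ij jk; rewrite /arrow_order ij_c ik_c -(congN_transl k ij_c) ik_c.
  by rewrite -(descends_congN ij_c); case: ifP => _; lia.
- exact: left ij_c ik_c ij jk.
- move: ij jk; rewrite /arrow_order (negPf ij_c) ik_c -(congN_transr j ik_c) congN_sym.
  rewrite (negPf ij_c).
  (* Here [i --> j --> i + m * N], so [j] itself decides the direction: it witnesses descent if
     [m < 0] and excludes it if [m > 0]. *)
  move: ik_c => /congNP[m ->] ij jm.
  have mji : j + (- m) * N --> i by rewrite -(shift m) mulNr subrK.
  have ij0 : i --> j + 0 * N by rewrite mul0r addr0.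
  have N0 := modN_gt0 n.
  have [m0|m0|m0] := ltgtP m 0.
  - suff -> : descends i by move: (N) N0 => M; nia.
    by apply/asboolP; exists j, 0, (- m); split=> //; rewrite oppr_gt0.
  - rewrite (negPf (not_descends ij_c _ mji ij0)) ?oppr_lt0//.
    by move: (N) N0 => M; nia.
  - by move: jm; rewrite m0 mul0r addr0 => /(asym ij).
have [jk_c|jk_c] := boolP (j ~~N k).
  (* Negation reverses the chain to [- k], [- j], [- i], with the congruent pair first. *)
  rewrite -arrow_order_opp; apply: (left _ (- j));
    by rewrite ?arrow_order_opp// congN_opp congN_sym.
move: ij jk; rewrite /arrow_order (negPf ij_c) (negPf ik_c) (negPf jk_c).
exact: arrow_trans.
Qed.

Lemma arrow_order_invariant : invariant_order n arrow_order.
Proof.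
split; first split.
- exact: arrow_order_irr.
- exact: arrow_order_trans.
- exact: arrow_order_total.
- by move=> i j; rewrite -(arrow_order_shift 1) !mul1r.
- by move=> i j; rewrite arrow_order_opp.
Qed.

End OrderOfArrow.

(** * Comparison of two orders *)

Section Comparison.

Variable n : nat.
Local Notation N := (modN n).

Lemma residue_classP r i : residue_class n r i <-> congN n i r.
Proof. by rewrite congN_eqmod; split=> /eqP. Qed.

Lemma ascending_congN prec i j : invariant_order n prec ->
  congN n i j -> ascending n prec i = ascending n prec j.
Proof.
move=> hp /congNP[k ->].
by rewrite /ascending addrAC (prec_shift hp).
Qed.

Lemma prec_congN prec i j : invariant_order n prec -> congN n i j ->
  prec i j = if ascending n prec i then i < j else j < i.
Proof.
move=> hp /congNP[k ->].
have -> : prec i (i + k * N) = prec (i + 0 * N) (i + k * N) by rewrite mul0r addr0.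
have N0 := modN_gt0 n; case: ifPn => ai.
  by rewrite (ascendingP hp)//; move: (N) N0 => M; nia.
by rewrite (descendingP _ _ hp)//; move: (N) N0 => M; nia.
Qed.

(** After translation [m = 0]: negation invariance places 0 between [x] and [- x]. *)
Lemma prec_reflect prec i m : invariant_order n prec -> (N %| m)%Z ->
  prec i m = prec i (m + m - i).
Proof.
move=> hp /dvdzP[k ->]; set m' := k * N.
have -> : i = (i - m') + m' by rewrite subrK.
move: (i - m') => x; rewrite (_ : m' + m' - _ = - x + m'); last by ring.
have -> : prec (x + m') m' = prec x 0 by rewrite -(prec_shift hp k x 0) add0r.
rewrite (prec_shift hp).
apply/idP/idP => [x0|xx].
  by apply: (prec_trans hp x0); rewrite -(prec_opp hp) opprK oppr0.
apply/negPn/negP; have [x0|x0] := eqVneq x 0.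
  by rewrite x0 oppr0 (precxx hp) in xx.
rewrite (precNge hp)// => ox.
have := ox; rewrite -(prec_opp hp) oppr0 => /(prec_trans hp)/(_ ox).
by rewrite (prec_asym hp).
Qed.

Lemma prec_agree prec prec' : invariant_order n prec -> invariant_order n prec' ->
  (forall i j, root_index n i j -> prec i j = prec' i j) ->
  forall i j, ~~ congN n i j -> prec i j = prec' i j.
Proof.
move=> hp hp' agree.
have zero_r i j : (N %| j)%Z -> ~~ congN n i j -> prec i j = prec' i j.
  move=> jN ij; rewrite (prec_reflect _ hp jN) (prec_reflect _ hp' jN).
  move: jN ij; rewrite congN0 => j0; rewrite -(congN_transr _ j0) congN_sym -congN0 => iN.
  move: j0 => /congNP[k ->]; apply: agree.
  rewrite add0r (_ : _ - i = - i + (k + k) * N); last by ring.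
  apply/root_indexP; rewrite (congN_shiftr n i) congN_oppr !congN0.
  by rewrite congN_shiftr -!congN0 rpredN.
move=> i j ij; have [j0|j0] := boolP (N %| j)%Z; first exact: zero_r.
have [i0|i0] := boolP (N %| i)%Z; last by apply: agree; apply/root_indexP.
rewrite -(prec_opp hp) -(prec_opp hp'); apply: zero_r; first by rewrite rpredN.
by rewrite congN_opp congN_sym.
Qed.

Lemma same_up_to_reversalP prec prec' :
    invariant_order n prec -> invariant_order n prec' ->
  same_up_to_reversal n prec prec' <->
  forall i j, ~~ congN n i j -> prec i j = prec' i j.
Proof.
move=> hp hp'; split=> [[C [_ CE]] i j ij|agree].
  apply/idP/idP; rewrite CE /reverse_classes; case: asboolP => //.
    move=> [r _ [/residue_classP ir /residue_classP jr]].
    by rewrite (congN_transl _ ir) congN_sym jr in ij.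
  move=> [r _ [/residue_classP ir /residue_classP jr]].
  by rewrite (congN_transl _ ir) congN_sym jr in ij.
(* The classes to reverse are those whose directions differ. A non-congruent [k] between two
   elements of such a class would order these two alike in both orders, so the directions would
   agree. *)
exists [set r | ascending n prec r != ascending n prec' r]%classic; split.
  move=> r /= Cr i k j /residue_classP ir /residue_classP jr ik kj.
  apply/residue_classP/negPn/negP => kr.
  have ij : congN n i j by rewrite (congN_transl _ ir) congN_sym.
  have ik' : prec' i k by rewrite -agree// (congN_transl _ ir) congN_sym.
  have kj' : prec' k j by rewrite -agree// (congN_transr _ jr).
  have := prec_trans hp ik kj; have := prec_trans hp' ik' kj'.
  rewrite (prec_congN hp ij) (prec_congN hp' ij) (ascending_congN hp ir).
  rewrite (ascending_congN hp' ir); move: Cr.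
  by case: (ascending _ prec r); case: (ascending _ prec' r) => //= _; lia.
move=> i j; rewrite /reverse_classes; case: asboolP => [[r /= Cr []]|nC].
  move=> /residue_classP ir /residue_classP jr.
  have ij : congN n i j by rewrite (congN_transl _ ir) congN_sym.
  have ji : congN n j i by rewrite congN_sym.
  rewrite (prec_congN hp ji) (prec_congN hp' ij) (ascending_congN hp jr).
  rewrite (ascending_congN hp' ir).
  by move: Cr; case: (ascending _ prec r); case: (ascending _ prec' r).
have [ij|ij] := boolP (congN n i j); last by rewrite agree.
rewrite (prec_congN hp ij) (prec_congN hp' ij).
suff -> : ascending n prec i = ascending n prec' i by [].
apply/eqP/negPn/negP => Ci; apply: nC; exists i => //.
by split; apply/residue_classP; rewrite ?congNxx// congN_sym.
Qed.

End Comparison.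

(** * Realizing biclosed sets and comparing inversion sets *)

Section Realization.

Variables (R : realType) (n : nat).
Local Notation N := (modN n).
Local Notation e := (et R n).

Lemma arrowE (B : set (Vt R n)) i j : root_index n i j ->
  arrow B i j = `[< out_side B (e j - e i) >].
Proof.
move=> /root_indexP[/negPf iN /negPf jN _].
by rewrite /arrow /ray_root /ray_scale iN jN scale1r.
Qed.

(** On root indices [prec] is [arrow B], and for [i < j] the negative root [e i - e j] is on the out
    side exactly when [e j - e i] lies in [B]. *)
Lemma biclosed_inversions (B : set (Vt R n)) : biclosed B ->
  exists prec : rel int, invariant_order n prec /\ B = inversions R n prec.
Proof.
move=> hB; pose prec := arrow_order n (arrow B).
have hp : invariant_order n prec.
  apply: arrow_order_invariant.
  - exact: arrow_shift.
  - exact: arrow_opp.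
  - exact: arrow_total.
  - exact: arrow_asym hB.
  - exact: arrow_acyclic hB.
  - exact: arrow_convex hB.
exists prec; split=> //; apply/seteqP; split=> v.
  move=> Bv; have [i [j [ij lt_ij vE]]] := hB.1 _ Bv.
  exists i, j; split=> //; have ji := root_index_sym ij.
  have /root_indexP[_ _ /negPf nji] := ji.
  rewrite /prec /arrow_order nji arrowE//; apply/asboolP; right.
  by rewrite opprB -vE; split=> //; exact: hB.1.
move=> [i [j [ij lt_ij pji ->]]]; have ji := root_index_sym ij.
have /root_indexP[_ _ /negPf nji] := ji.
move: pji; rewrite /prec /arrow_order nji arrowE// => /asboolP[[]|[_]].
  by move=> /(pos_rootsE _ ji); rewrite ltNge (ltW lt_ij).
by rewrite opprB.
Qed.

Lemma inversions_eqP prec prec' :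
    invariant_order n prec -> invariant_order n prec' ->
  inversions R n prec = inversions R n prec' <->
  forall i j, ~~ congN n i j -> prec i j = prec' i j.
Proof.
move=> hp hp'; split=> [eq_inv|agree]; last first.
  apply/seteqP; split=> v [i [j [ij lt_ij pji ->]]]; exists i, j; split=> //;
    have /root_indexP[_ _] := root_index_sym ij.
    by move=> /agree <-.
  by move=> /agree ->.
apply: prec_agree => // i j ij.
have lt_agree k l : root_index n k l -> k < l -> prec l k = prec' l k.
  move=> kl lt_kl; apply/idP/idP => /(inversionsE R _ kl lt_kl).
    by move=> /(_ hp); rewrite eq_inv => /(inversionsE R hp' kl lt_kl).
  by move=> /(_ hp'); rewrite -eq_inv => /(inversionsE R hp kl lt_kl).
have ji := root_index_sym ij; have nij := root_index_neq ij.
have [lt_ij|lt_ji|/eqP] := ltgtP i j; last by rewrite (negPf nij).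
  by rewrite -(precNge hp) 1?eq_sym// -(precNge hp') 1?eq_sym// (lt_agree i j).
exact: lt_agree.
Qed.

End Realization.

Theorem theorem5p9 (R : realType) (n : nat) (n_gt0 : (0 < n)%N) :
  (forall prec : rel int,
     invariant_order n prec -> biclosed (inversions R n prec)) /\
  (forall B : set (Vt R n), biclosed B ->
     exists prec : rel int, invariant_order n prec /\ B = inversions R n prec) /\
  (forall prec prec' : rel int,
     invariant_order n prec -> invariant_order n prec' ->
     (inversions R n prec = inversions R n prec' <->
      same_up_to_reversal n prec prec')).
Proof.
split; first exact: inversions_biclosed.
split; first exact: biclosed_inversions.
move=> prec prec' hp hp'.
exact: iff_trans (inversions_eqP R hp hp') (iff_sym (same_up_to_reversalP hp hp')).
Qed.
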